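(* Let $k\geq 1$ and $n\geq 6k^3$ be integers. Then every graph $F$ of order $n$ with $\delta(F)\geq n-k$ contains every connected graph $G$ with $n$ vertices, at most $n\left(1+\frac{1}{24k-12}\right)$ edges and $\alpha'(G)\geq k-1$.
   Context: All graphs are finite and simple; the order of a graph is its number of vertices. $\delta(F)$ is the minimum degree of $F$. ''$F$ contains $G$'' means that $G$ is isomorphic to a (not necessarily induced) subgraph of $F$. For a graph $G$ and a vertex $v\in V(G)$, $N(v)$ is the set of neighbours of $v$, $N[v]=N(v)\cup\{v\}$, and $G_v=G-N[v]$ is the graph obtained from $G$ by deleting all vertices of $N[v]$. The independence number $\alpha(H)$ of a graph $H$ is the maximum size of an independent set (so it is $0$ if $H$ has no vertices). Define $\alpha'(G)=\min\{\alpha(G_v): v\in V(G)\}$. *)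

(* Defs.v *)
From mathcomp Require Import all_boot all_order all_algebra.

Set Implicit Arguments.
Unset Strict Implicit.
Unset Printing Implicit Defensive.

Record sgraph := SGraph {
  vertex :> finType;
  adj : rel vertex;
  adj_sym : symmetric adj;
  adj_irrefl : irreflexive adj
}.

Definition nbhd (G : sgraph) (v : G) : {set G} := [set u | adj v u].

Definition closed_nbhd (G : sgraph) (v : G) : {set G} := v |: nbhd v.

Definition degree (G : sgraph) (v : G) : nat := #|nbhd v|.

(* The seed #|G| exceeds every degree, so for a nonempty graph this is the
   minimum of the degrees. *)
Definition min_degree (G : sgraph) : nat := \big[minn/#|G|]_(v : G) degree v.

Definition edges (G : sgraph) : {set {set G}} :=
  [set [set p.1; p.2] | p : G * G & adj p.1 p.2].

Definition connected (G : sgraph) : Prop :=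
  forall x y : G, connect (@adj G) x y.

Section Induced.
Variables (G : sgraph) (A : {set G}).

Definition induced_vertex : finType := {x : G | x \in A}.

Definition induced_adj : rel induced_vertex :=
  [rel x y | adj (val x) (val y)].

Lemma induced_adj_sym : symmetric induced_adj.
Proof. by move=> x y; apply: adj_sym. Qed.

Lemma induced_adj_irrefl : irreflexive induced_adj.
Proof. by move=> x; apply: adj_irrefl. Qed.

Definition induced : sgraph := SGraph induced_adj_sym induced_adj_irrefl.

End Induced.

Definition del_closed_nbhd (G : sgraph) (v : G) : sgraph :=
  induced (~: closed_nbhd v).

Definition independent (G : sgraph) (S : {set G}) : bool :=
  [forall x in S, forall y in S, ~~ adj x y].

Definition alpha (G : sgraph) : nat :=
  \max_(S : {set G} | independent S) #|S|.

(* The seed #|G| is an upper bound of every term, so for a nonempty graph this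
   is the minimum over the vertices. *)
Definition alpha' (G : sgraph) : nat :=
  \big[minn/#|G|]_(v : G) alpha (del_closed_nbhd v).

(* An isomorphism from G onto a not necessarily induced subgraph of F is an
   injective, adjacency-preserving map from G to F. *)
Definition contains (F G : sgraph) : Prop :=
  exists f : G -> F,
    injective f /\ (forall x y : G, adj x y -> adj (f x) (f y)).

(* Main.v *)
Require Import Defs.
From mathcomp Require Import all_boot all_order all_algebra.
From mathcomp Require Import fingroup perm zify ring.

Set Implicit Arguments.
Unset Strict Implicit.
Unset Printing Implicit Defensive.

(** Put [d = k - 1].  The complement [h] of [F] has maximum degree at most [d],
    and a bijection between [V(G)] and [V(F)] reduces the theorem to packing:
    find a permutation [p] of [V(G)] such that no edge of [G] is sent onto an
    edge of [h].  Every construction below modifies such a permutation by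
    transpositions.

    Write [q] for the excess of edges over vertices of [G].  Since [G] is
    connected, every vertex set [M] spans at most [|M| + q] edges
    ([sparse_of_connected]): the vertices outside [M] can be added one by one,
    each bringing a new edge.  Hence the vertices of [M] can be ordered so that
    all but the first [O(k + q)] have at most two earlier neighbours.  A vertex
    with [s] earlier neighbours has at most [s * d] forbidden positions, so a
    greedy placement works as long as [2 * d] vertices remain outside [M]
    ([packs_extend]).  It remains to reserve a good set for the end, and there
    are two ways.

    Either some vertex [v] has [2 * d] leaves.  The hypothesis on [alpha']
    gives an independent set avoiding [N[v]] that is large enough to cover all
    the [h]-neighbours of the position of [v]; fixing that first, greedy
    placement handles everything but the leaves of [v], and these may then go
    anywhere ([packs_star]).

    Or there is a set [I] of [4 * d] independent vertices of degree at most 2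
    such that every vertex has at most two neighbours in [I].  Greedy
    placement handles the complement of [I]; then any conflict in [I] is
    removed by exchanging two members of [I] ([packs_spread]).  Such a set [I]
    exists when no vertex has [2 * d] leaves: if [4 * d] vertices have leaves,
    take one leaf of each ([spread_leaves]).  Otherwise there are few leaves,
    the degree sum is close to [2 n], and so most vertices have degree at most
    2 together with all their neighbours ([card_thin]); a maximal independent
    set of those is large enough ([spread_thin]). *)

(** * Counting *)

Lemma card_bigcup_le (I T : finType) (P : pred I) (B : I -> {set T}) c :
  (forall i, P i -> #|B i| <= c) -> #|\bigcup_(i | P i) B i| <= #|P| * c.
Proof.
move=> Bc; apply: (@leq_trans (\sum_(i | P i) #|B i|)); last first.
  by rewrite -sum_nat_const; apply: leq_sum.
elim/big_ind2: _ => [|m X m' Y mX m'Y|//]; first by rewrite cards0.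
exact: leq_trans (leq_card_setU _ _) (leq_add mX m'Y).
Qed.

(** The final numerical step, with [n] vertices, [L] leaves, excess [q], [t]
    thin vertices, and an independent set of [j] thin vertices.  The bound on
    [q] gives [8 * q <= 2 * n / 9], and the cubic lower bound on [n] absorbs
    [4 * L]. *)
Lemma few_leaves_bound d q n L t j :
  0 < d -> 6 * d.+1 ^ 3 <= n -> q * (24 * d.+1 - 12) <= n ->
  n <= t + 8 * q + 4 * L -> L <= (4 * d).-1 * (2 * d).-1 -> t <= 3 * j ->
  4 * d <= j.
Proof.
case: d => // e _ leT leq_q leT_thin leL thinJ.
have le_36q : 36 * q <= n.
  by apply: leq_trans leq_q; rewrite mulnC leq_mul2l; apply/orP; right; lia.
have prod_pred : (4 * e.+1).-1 * (2 * e.+1).-1 = 8 * (e * e) + 10 * e + 3.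
  have -> : (4 * e.+1).-1 = 4 * e + 3 by lia.
  have -> : (2 * e.+1).-1 = 2 * e + 1 by lia.
  ring.
have cube : e.+2 ^ 3 = e * (e * e) + 6 * (e * e) + 12 * e + 8.
  rewrite -addn2; ring.
have square : 2 * e <= e * e + 1 by nia.
have cubic : e * (2 * e) <= e * (e * e + 1) by rewrite leq_mul2l square orbT.
rewrite prod_pred in leL; rewrite cube in leT.
lia.
Qed.

(** * Sparsity of connected graphs with few edges *)

Section Graph.
Variables (T : finType) (g : rel T).
Hypotheses (g_sym : symmetric g) (g_irr : irreflexive g).

Definition deg_in (A : {set T}) x := #|[set y in A | g x y]|.

Definition deg x := #|[set y | g x y]|.

(** Twice the number of edges spanned by [A]. *)
Definition degree_sum (A : {set T}) := \sum_(x in A) deg_in A x.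

Definition sparse q := forall A, degree_sum A <= (#|A| + q).*2.

Definition leaves := [set x | deg x == 1].

Lemma deg_in_setT x : deg_in setT x = deg x.
Proof. by apply: eq_card => y; rewrite !inE. Qed.

Lemma deg_in_le (A : {set T}) x : deg_in A x <= deg x.
Proof. by apply/subset_leq_card/subsetP => y; rewrite !inE => /andP[]. Qed.

Lemma deg_in_lt (A : {set T}) x : x \in A -> deg_in A x < #|A|.
Proof.
move=> xA; rewrite (cardsD1 x A) xA ltnS; apply/subset_leq_card/subsetP => y.
rewrite !inE => /andP[-> gxy]; rewrite andbT.
by apply: contraTneq gxy => ->; rewrite g_irr.
Qed.

Lemma leaf_nbr_uniq x y z : x \in leaves -> g x y -> g x z -> y = z.
Proof.
rewrite inE => /cards1P[w Ew] gxy gxz.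
have /set1P-> : y \in [set w] by rewrite -Ew inE.
by have /set1P-> : z \in [set w] by rewrite -Ew inE.
Qed.

Section Connected.
Hypothesis g_conn : forall x y, connect g x y.

Lemma edge_leaving (A : {set T}) x y :
  x \in A -> y \notin A -> exists u v, [/\ u \in A, v \notin A & g u v].
Proof.
move=> xA yA.
case: (boolP [exists u in A, exists v in ~: A, g u v]) => [|noedge].
  case/exists_inP=> u uA /exists_inP[v]; rewrite inE => vA guv.
  by exists u, v.
have cl : closed g [in A].
  apply: intro_closed (sym_connect_sym g_sym) _ _ => u v guv uA.
  apply: contraNT noedge => vA; apply/exists_inP; exists u => //.
  by apply/exists_inP; exists v; rewrite ?inE.
by have := closed_connect cl (g_conn x y); rewrite xA (negPf yA).
Qed.

Lemma degree_sum_setU1 (A : {set T}) u v :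
  u \in A -> v \notin A -> g u v -> degree_sum A + 2 <= degree_sum (v |: A).
Proof.
move=> uA vA guv.
have split_u (F : T -> nat) :
  \sum_(x in A) F x = F u + \sum_(x in A | x != u) F x by exact: bigD1.
rewrite /degree_sum big_setU1 //= !split_u.
have le1 : 1 <= deg_in (v |: A) v.
  by apply/card_gt0P; exists u; rewrite !inE uA orbT g_sym.
have le2 : deg_in A u + 1 <= deg_in (v |: A) u.
  rewrite addn1 /deg_in (cardsD1 v [set y in v |: A | g u y]).
  rewrite !inE eqxx guv /= ltnS.
  apply/subset_leq_card/subsetP => y; rewrite !inE => /andP[yA ->].
  by rewrite yA orbT !andbT; apply: contraNneq vA => <-.
have le3 : \sum_(i in A | i != u) deg_in A i
    <= \sum_(i in A | i != u) deg_in (v |: A) i.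
  apply: leq_sum => i _; apply/subset_leq_card/subsetP => y.
  by rewrite !inE => /andP[-> ->]; rewrite orbT.
lia.
Qed.

(** By connectivity the set [A] can be enlarged one vertex at a time up to the
    whole graph, and each new vertex adds at least one edge, hence 2 to the
    degree sum. *)
Lemma sparse_of_connected q : degree_sum setT <= (#|T| + q).*2 -> sparse q.
Proof.
move=> tot A; have [->|[x xA]] := set_0Vmem A.
  by rewrite /degree_sum big_set0.
suff: degree_sum A + #|~: A|.*2 <= degree_sum setT by have := cardsC A; lia.
move: {2}#|~: A| (leqnn #|~: A|) => m.
elim: m A xA => [|m IHm] A xA leA.
  have -> : A = setT.
    apply: (can_inj (@setCK _)); rewrite setCT; apply/eqP.
    by rewrite -cards_eq0 -leqn0.
  by rewrite setCT cards0 addn0.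
have [A0|[y]] := set_0Vmem (~: A).
  by apply: IHm => //; rewrite A0 cards0.
rewrite inE => /(edge_leaving xA)[u [v [uA vA guv]]].
have cA : #|~: A| = #|~: (v |: A)|.+1.
  by rewrite setCU setIC -setDE [LHS](cardsD1 v) inE vA.
have := IHm (v |: A); rewrite !inE xA orbT => /(_ isT).
have := degree_sum_setU1 uA vA guv; lia.
Qed.

Lemma deg_gt0 x : 1 < #|T| -> 0 < deg x.
Proof.
move=> T1; have [y yx] : exists y, y \notin [set x].
  apply/existsP; rewrite -negb_forall; apply: contraTN T1 => /forallP all1.
  by rewrite -leqNgt -cardsT -(cards1 x); apply/subset_leq_card/subsetP => y _.
have [u [v [/set1P-> _ gxv]]] := edge_leaving (set11 x) yx.
by apply/card_gt0P; exists v; rewrite inE.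
Qed.

(** Two adjacent leaves would form a whole connected component. *)
Lemma leaves_not_adjacent x y :
  2 < #|T| -> x \in leaves -> y \in leaves -> ~~ g x y.
Proof.
move=> T2 xL yL; apply/negP => gxy.
have [z zxy] : exists z, z \notin [set x; y].
  apply/existsP; rewrite -negb_forall; apply: contraTN T2 => /forallP all1.
  rewrite -leqNgt -cardsT; apply: leq_trans (_ : #|[set x; y]| <= 2).
    by apply/subset_leq_card/subsetP => z _.
  by rewrite cards2; case: (x != y).
have [u [v [uxy vxy guv]]] := edge_leaving (set21 x y) zxy.
case/set2P: uxy guv => -> guv; case/negP: vxy; rewrite !inE.
  by rewrite (leaf_nbr_uniq xL guv gxy) eqxx orbT.
by rewrite (leaf_nbr_uniq yL guv (_ : g y x)) ?eqxx // g_sym.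
Qed.

(** * Spread sets *)

Definition leaves_at v := [set x in leaves | g v x].

(** Sets whose members can be placed last: by independence each placement
    depends only on vertices outside [I], and the two degree bounds keep the
    number of bad exchanges of a given member below [4 * d]. *)
Definition spread (I : {set T}) :=
  [/\ {in I &, forall x y, ~~ g x y}, {in I, forall x, deg x <= 2}
    & forall y, deg_in I y <= 2].

Lemma spread_leaves :
  2 < #|T| -> exists2 I, spread I & #|I| = #|[set v | leaves_at v != set0]|.
Proof.
move=> T2; set Q := [set v | _].
pose leaf v := odflt v [pick x in leaves_at v].
have leafP v : v \in Q -> leaf v \in leaves /\ g v (leaf v).
  rewrite inE /leaf; case: pickP => [x|no]; first by rewrite inE => /andP.
  by case/set0Pn => x; rewrite no.
have nbr_leaf v y : v \in Q -> g y (leaf v) -> y = v.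
  by case/leafP => vL gv gy; apply: leaf_nbr_uniq vL _ _; rewrite g_sym.
exists (leaf @: Q); last first.
  apply: card_in_imset => v w vQ wQ eq_vw.
  by apply: nbr_leaf => //; rewrite -eq_vw; have [] := leafP v vQ.
split.
- move=> _ _ /imsetP[v /leafP[vL _] ->] /imsetP[w /leafP[wL _] ->].
  exact: leaves_not_adjacent.
- by move=> _ /imsetP[v /leafP[+ _] ->]; rewrite inE => /eqP->.
move=> y; apply: (@leq_trans #|[set leaf y]|); last by rewrite cards1.
apply/subset_leq_card/subsetP => x; rewrite !inE => /andP[/imsetP[v vQ ->]].
by move/(nbr_leaf _ _ vQ) ->.
Qed.

Lemma leaves_le c :
  (forall v, #|leaves_at v| <= c) ->
  #|leaves| <= #|[set v | leaves_at v != set0]| * c.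
Proof.
move=> le_c; set Q := [set v | _].
suff cover : leaves \subset \bigcup_(v in Q) leaves_at v.
  by apply: leq_trans (subset_leq_card cover) (card_bigcup_le _) => v _.
apply/subsetP => x xL; move: (xL); rewrite inE => /cards1P[v Ev].
have gxv : g v x by rewrite g_sym; have := set11 v; rewrite -Ev inE.
have x_at : x \in leaves_at v by rewrite inE xL.
by apply/bigcupP; exists v => //; rewrite inE; apply/set0Pn; exists x.
Qed.

Definition thin := [set x | (deg x <= 2) && [forall (y | g x y), deg y <= 2]].

(** A maximal independent set [I] of thin vertices works: its closed
    neighbourhoods have at most 3 elements and cover all thin vertices, and any
    neighbour of [I] has degree at most 2. *)
Lemma spread_thin : exists2 I, spread I & #|thin| <= 3 * #|I|.
Proof.
pose P (I : {set T}) :=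
  (I \subset thin) && [forall x in I, forall y in I, ~~ g x y].
have P0 : P set0.
  by rewrite /P sub0set; apply/forall_inP => x; rewrite inE.
case: (arg_maxnP (fun I : {set T} => #|I|) P0) => I.
case/andP=> Ithin /forall_inP indep max_I.
have indepI : {in I &, forall x y, ~~ g x y}.
  by move=> x y xI yI; have /forall_inP := indep x xI; apply.
have thinI x : x \in I -> (deg x <= 2) /\ (forall y, g x y -> deg y <= 2).
  by move/(subsetP Ithin); rewrite inE => /andP[-> /forall_inP].
exists I; first split=> //.
- by move=> x /thinI[].
- move=> y; have [->//|] := posnP (deg_in I y).
  case/card_gt0P=> x; rewrite inE => /andP[/thinI[_ nbr] gyx].
  by apply: leq_trans (deg_in_le _ _) (nbr _ _); rewrite g_sym.
have cover : thin \subset \bigcup_(x in I) (x |: [set y | g x y]).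
  apply/subsetP => z zthin; apply/bigcupP.
  case: (boolP (z \in I)) => zI; first by exists z; rewrite ?setU11.
  case: (boolP [exists x in I, g x z]) => [/exists_inP[x xI gxz]|no].
    by exists x => //; rewrite !inE gxz orbT.
  have noedge x : x \in I -> ~~ g x z.
    by move=> xI; apply: contra no => gxz; apply/exists_inP; exists x.
  have /max_I : P (z |: I).
    rewrite /P subUset sub1set zthin Ithin /=.
    apply/forall_inP => x /setU1P[->|xI]; apply/forall_inP => y /setU1P[->|yI].
    - by rewrite g_irr.
    - by rewrite g_sym noedge.
    - exact: noedge.
    exact: indepI.
  by rewrite /= cardsU1 zI add1n /geq /= ltnn.
apply: leq_trans (subset_leq_card cover) _; rewrite mulnC.
apply: card_bigcup_le => x /thinI[deg2 _].
by rewrite cardsU1 inE g_irr /= add1n ltnS.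
Qed.

(** A vertex that is not thin lies in the closed neighbourhood of a vertex of
    degree at least 3.  The size of such a neighbourhood is at most four times
    the excess of its degree over 2, and the sum of these excesses is at most
    [2 * q] plus the number of leaves. *)
Lemma card_thin q :
  (forall x, 0 < deg x) -> degree_sum setT <= (#|T| + q).*2 ->
  #|T| <= #|thin| + 8 * q + 4 * #|leaves|.
Proof.
move=> deg_pos tot; pose B := [set x | 2 < deg x].
have coverC : ~: thin \subset \bigcup_(x in B) (x |: [set y | g x y]).
  apply/subsetP => z; rewrite !inE negb_and -ltnNge negb_forall_in.
  move=> zthin; apply/bigcupP; case/orP: zthin => [zB|/exists_inP[y gzy yB]].
    by exists z; rewrite !inE ?eqxx.
  by exists y; rewrite !inE ?ltnNge // g_sym gzy orbT.
have cardC : #|~: thin| <= \sum_(x in B) (deg x).+1.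
  apply: leq_trans (subset_leq_card coverC) _.
  elim/big_ind2: _ => [|m X m' Y mX m'Y|x _]; first by rewrite cards0.
    exact: leq_trans (leq_card_setU _ _) (leq_add mX m'Y).
  by rewrite cardsU1 inE g_irr.
(* This is [8 + (deg x).+1 <= 4 * deg x] when [deg x >= 3]; a leaf needs the
   extra 4, and degree 2 gives equality. *)
have ptwise : \sum_x (8 + (if x \in B then (deg x).+1 else 0))
    <= \sum_x (4 * deg x + (if x \in leaves then 4 else 0)).
  apply: leq_sum => x _; rewrite !inE; have := deg_pos x.
  by case: ifP => ?; case: ifP => ?; lia.
have totE : degree_sum setT = \sum_x deg x.
  by rewrite /degree_sum; apply: eq_big => x; rewrite ?inE ?deg_in_setT.
have mul4 : \sum_x 4 * deg x = 4 * degree_sum setT by rewrite totE big_distrr.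
have const8 : \sum_(x : T) 8 = #|T| * 8 by rewrite sum_nat_const.
have sumB : \sum_x (if x \in B then (deg x).+1 else 0)
    = \sum_(x in B) (deg x).+1.
  by rewrite [RHS]big_mkcond.
have sumL : \sum_x (if x \in leaves then 4 else 0) = #|leaves| * 4.
  by rewrite -big_mkcond sum_nat_const.
move: ptwise; rewrite 2!big_split /= mul4 const8 sumB sumL.
have := cardsC thin; move: cardC tot; rewrite -!(cardsT T); lia.
Qed.

End Connected.
End Graph.

(** * Packing by transpositions *)

Section Packing.
Variables (T : finType) (g h : rel T) (d : nat).
Hypotheses (g_sym : symmetric g) (g_irr : irreflexive g).
Hypotheses (h_sym : symmetric h) (h_irr : irreflexive h).
Hypothesis h_deg : forall w, deg h w <= d.

(** [p] places the subgraph of [g] induced by [A] without conflict; its values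
    outside [A] are provisional. *)
Definition packs (A : {set T}) (p : {perm T}) :=
  [forall x in A, forall y in A, g x y ==> ~~ h (p x) (p y)].

Lemma packsP (A : {set T}) (p : {perm T}) :
  reflect {in A &, forall x y, g x y -> ~~ h (p x) (p y)} (packs A p).
Proof.
apply: (iffP forall_inP) => packA x.
  by move=> y xA yA; have /forall_inP/(_ y yA)/implyP := packA x xA.
by move=> xA; apply/forall_inP => y yA; apply/implyP; apply: packA.
Qed.

Lemma card_clash (p : {perm T}) w : #|[set y | h w (p y)]| <= d.
Proof.
apply: leq_trans (h_deg w); rewrite -[leqRHS](card_preimset _ (@perm_inj _ p)).
by apply/subset_leq_card/subsetP => y; rewrite !inE.
Qed.

Lemma card_blocked (p : {perm T}) (U : {set T}) :
  #|\bigcup_(u in U) [set y | h (p u) (p y)]| <= #|U| * d.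
Proof. by apply: card_bigcup_le => u _; apply: card_clash. Qed.

(** The neighbours of [x] in [A] forbid at most [deg_in g A x * d] positions,
    so some vertex outside [A] holds a position that suits [x]: exchange the
    two. *)
Lemma packs_setU1 (A : {set T}) x p :
  x \notin A -> packs A p -> deg_in g A x * d < #|~: A| ->
  exists2 q, packs (x |: A) q & {in A, q =1 p}.
Proof.
move=> xA /packsP packA room; set U := [set y in A | g x y].
pose Z := \bigcup_(u in U) [set y | h (p u) (p y)].
have [y yA yZ] : exists2 y, y \notin A & y \notin Z.
  have /subsetPn[y] : ~~ (~: A \subset Z).
    apply: contraL room => /subset_leq_card leZ; rewrite -leqNgt.
    exact: leq_trans leZ (card_blocked _ _).
  by rewrite inE; exists y.
pose q : {perm T} := (tperm x y * p)%g.
have qA : {in A, q =1 p}.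
  by move=> z zA; rewrite permM tpermD //; apply: contraTneq zA => <-.
have qx : q x = p y by rewrite permM tpermL.
have ok u : u \in A -> g x u -> ~~ h (q x) (q u).
  move=> uA gxu; rewrite qx qA //; apply: contra yZ => hyu.
  by apply/bigcupP; exists u; rewrite !inE ?uA // h_sym.
exists q => //; apply/packsP => u v /setU1P[->|uA] /setU1P[->|vA].
- by rewrite g_irr.
- exact: ok.
- by rewrite g_sym h_sym; apply: ok.
by rewrite !qA //; apply: packA.
Qed.

(** Induction on [M], removing a suitable vertex [x] of [M] outside [P], which
    is placed last.  If some candidate has at most two neighbours in [M], the
    room outside [M] suffices for it.  If all have at least three, sparsity
    forces [#|M| <= 3 * m + 2 * q]; then [M] is so small that even [#|M| - 1]
    neighbours leave enough room. *)
Lemma packs_extend m q (P M : {set T}) p :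
  sparse g q -> #|P| <= m -> d < m -> m * (3 * m + 2 * q) <= #|T| ->
  P \subset M -> 2 * d <= #|~: M| -> packs P p ->
  exists2 p', packs M p' & {in P, p' =1 p}.
Proof.
move=> g_sparse Pm dm mT PM room packP.
move: {2}#|M :\: P| (leqnn #|M :\: P|) => c.
elim: c M PM room => [|c IHc] M PM room leM.
  suff <- : P = M by exists p.
  by apply/eqP; rewrite eqEsubset PM -setD_eq0 -cards_eq0 -leqn0.
have [MP0|[x0 x0MP]] := set_0Vmem (M :\: P).
  by apply: IHc => //; rewrite MP0 cards0.
have cardM := cardsC M; rewrite -(cardsT T) in mT cardM.
have [x xMP room_x] : exists2 x, x \in M :\: P & deg_in g M x * d <= #|~: M|.
  case: (boolP [exists x in M :\: P, deg_in g M x <= 2]).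
    case/exists_inP=> x xMP le2.
    by exists x => //; apply: leq_trans room; rewrite leq_mul2r le2 orbT.
  rewrite negb_exists_in => /forall_inP big.
  have leM3 : #|M| <= 3 * m + 2 * q.
    have cMP := cardsID P M; rewrite (setIidPr PM) in cMP.
    have le3 : #|M :\: P| * 3 <= degree_sum g M.
      rewrite -sum_nat_const /degree_sum [leqRHS](big_setID P) /=.
      apply: leq_trans (leq_addl _ _); apply: leq_sum => x /big.
      by rewrite -ltnNge.
    have := g_sparse M; lia.
  exists x0 => //.
  have /deg_in_lt : x0 \in M by case/setDP: x0MP.
  move/(_ g g_irr) => lt_deg.
  have : (deg_in g M x0).+1 * d.+1 <= (3 * m + 2 * q) * m.
    by apply: leq_mul => //; apply: leq_trans leM3.
  nia.
case/setDP: xMP => xM xP; have MxM : M = x |: (M :\ x) by rewrite setD1K.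
have cM : #|~: (M :\ x)| = #|~: M|.+1.
  by rewrite setCD setUC cardsU1 !inE xM.
have [|||p' packMx p'P] := IHc (M :\ x).
- by rewrite subsetD1 PM.
- by rewrite cM ltnW.
- move: leM; rewrite (cardsD1 x) !inE xP xM /= add1n ltnS; congr (_ <= _).
  by apply: eq_card => y; rewrite !inE; case: (y == x); rewrite ?andbF.
have [||p2 pack2 p2P] := @packs_setU1 (M :\ x) x p' _ packMx.
- by rewrite !inE eqxx.
- rewrite cM ltnS; apply: leq_trans room_x; rewrite leq_mul2r; apply/orP; right.
  by apply/subset_leq_card/subsetP => y; rewrite !inE -andbA => /and3P[_ -> ->].
exists p2; first by rewrite MxM.
move=> z zP; rewrite p2P ?p'P // !inE (subsetP PM) // andbT.
by apply: contraNneq xP => <-.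
Qed.

(** Take [p] with the fewest conflicting vertices in [I].  For a conflicting
    [x], an exchange of [x] and [y] fails only if [p y] is bad for [x]
    ([y \in X1]) or [p x] is bad for [y] ([y \in X2]).  Both sets have at most
    [2 * d] elements and share [x], so some [y] in [I] avoids them, and the
    exchange contradicts minimality: as [I] is independent and [p] changes only
    on [I], the other members of [I] are unaffected. *)
Lemma packs_spread (I : {set T}) p :
  spread g I -> 4 * d <= #|I| -> packs (~: I) p -> exists p', packs setT p'.
Proof.
case=> indep deg2 nbr2 leI packI.
pose bad (p : {perm T}) x := [exists u, g x u && h (p x) (p u)].
have := arg_minnP (fun p => #|[set x in I | bad p x]|) packI.
case=> {packI} {}p packI min_p.
have [bad0|[x]] := set_0Vmem [set x in I | bad p x].
  have good x y : x \in I -> g x y -> ~~ h (p x) (p y).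
    move=> xI gxy; apply/negP => hxy; have := in_set0 x; rewrite -bad0 inE xI.
    by move/negbT/existsP; apply; exists y; rewrite gxy.
  exists p; apply/packsP => x y _ _ gxy.
  case: (boolP (x \in I)) => [xI|xI]; first exact: good.
  case: (boolP (y \in I)) => [yI|yI]; first by rewrite h_sym good // g_sym.
  by have /packsP := packI; apply; rewrite ?inE.
rewrite inE => /andP[xI badx].
pose X1 := \bigcup_(u in [set u | g x u]) [set y | h (p u) (p y)].
pose X2 := \bigcup_(u in [set u | h (p x) (p u)]) [set y in I | g u y].
have X1le : #|X1| <= 2 * d.
  by apply: leq_trans (card_blocked _ _) _; rewrite leq_mul2r deg2 ?orbT.
have X2le : #|X2| <= d * 2.
  apply: leq_trans (card_bigcup_le (fun u _ => nbr2 u)) _.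
  by rewrite leq_mul2r card_clash orbT.
have xX : x \in X1 :&: X2.
  have /existsP[u /andP[gxu hxu]] := badx.
  rewrite inE; apply/andP; split; apply/bigcupP; exists u; rewrite !inE //.
    by rewrite h_sym.
  by rewrite xI g_sym.
have [y yI] : exists2 y, y \in I & y \notin X1 :|: X2.
  have /subsetPn[y yI yX] : ~~ (I \subset X1 :|: X2); last by exists y.
  apply/negP => /subset_leq_card; rewrite cardsU.
  have : 0 < #|X1 :&: X2| by apply/card_gt0P; exists x.
  have : #|X1 :&: X2| <= #|X1| by apply/subset_leq_card/subsetIl.
  lia.
rewrite inE negb_or => /andP[yX1 yX2].
have xy : x != y by apply: contraNneq yX1 => <-; case/setIP: xX.
pose q : {perm T} := (tperm x y * p)%g.
have q_out z : x != z -> y != z -> q z = p z.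
  by move=> xz yz; rewrite permM tpermD.
have q_notI z : z \notin I -> q z = p z.
  by move=> zI; apply: q_out; apply: contraNneq zI => <-.
have nbr_notI z u : z \in I -> g z u -> u \notin I.
  by move=> zI gzu; apply/negP => uI; have := indep z u zI uI; rewrite gzu.
have good_x : ~~ bad q x.
  apply/existsP => -[u /andP[gxu]].
  rewrite (q_notI u) ?(nbr_notI _ _ xI gxu)//.
  rewrite permM tpermL => hyu; case/negP: yX1; apply/bigcupP.
  by exists u; rewrite inE // h_sym.
have good_y : ~~ bad q y.
  apply/existsP => -[u /andP[gyu]].
  rewrite (q_notI u) ?(nbr_notI _ _ yI gyu)//.
  rewrite permM tpermR => hxu; case/negP: yX2; apply/bigcupP.
  by exists u; rewrite !inE // yI g_sym.
have /min_p : packs (~: I) q.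
  apply/packsP => u v; rewrite !inE => uI vI guv; rewrite !q_notI //.
  by have /packsP := packI; apply; rewrite ?inE.
suff lt_bad : #|[set z in I | bad q z]| < #|[set z in I | bad p z]|.
  by rewrite leqNgt lt_bad.
apply: proper_card; apply/properP; split; last first.
  by exists x; rewrite !inE xI //= (negPf good_x).
apply/subsetP => z; rewrite !inE => /andP[zI]; rewrite zI.
have [<-|xz] := eqVneq x z; first by rewrite (negPf good_x).
have [<-|yz] := eqVneq y z; first by rewrite (negPf good_y).
case/existsP=> u /andP[gzu].
rewrite q_out // (q_notI u) ?(nbr_notI _ _ zI gzu)//.
by move=> hzu; apply/existsP; exists u; rewrite gzu.
Qed.

(** If an [h]-neighbour of the position of [v] is held outside [S], then some
    member of [S] does not hold one, and exchanging the two covers one more. *)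
Lemma cover_clashes v (S : {set T}) :
  v \notin S -> d <= #|S| ->
  exists p : {perm T}, forall y, h (p v) (p y) -> y \in S.
Proof.
move=> vS dS; pose clash (p : {perm T}) := [set y | h (p v) (p y)].
have [p _ max_p] := @arg_maxnP _ 1%g predT (fun p => #|clash p :&: S|) isT.
exists p => y hy; apply: contraT => yS.
have [s sS no_hs] : exists2 s, s \in S & ~~ h (p v) (p s).
  have /subsetPn[s sS] : ~~ (S \subset clash p :\ y).
    apply/negP => /subset_leq_card.
    have : #|clash p| <= d := card_clash p (p v).
    rewrite (cardsD1 y (clash p)) inE hy => le_d leS.
    by have := leq_trans le_d (leq_trans dS leS); rewrite ltnn.
  rewrite !inE negb_and negbK => /orP[/eqP sy|]; last by exists s.
  by rewrite -sy sS in yS.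
pose q : {perm T} := (tperm y s * p)%g.
have yv : y != v by apply: contraTneq hy => ->; rewrite h_irr.
have sv : s != v by apply: contraNneq vS => <-.
have qv : q v = p v by rewrite permM tpermD.
have := max_p q isT; rewrite /geq /= leqNgt => /negP[].
apply: proper_card; apply/properP; split.
  apply/subsetP => z; rewrite !inE qv => /andP[hz zS].
  rewrite zS andbT permM tpermD //.
    by apply: contraNneq yS => ->.
  by apply: contraNneq no_hs => ->.
exists s; first by rewrite !inE sS qv permM tpermR hy.
by rewrite !inE sS (negPf no_hs).
Qed.

(** The position of [v] has all its [h]-neighbours held by [S], so the greedy
    placement can start from these and [v], which are pairwise non-adjacent in
    [g].  Once everything but the leaves of [v] is placed, no position left for
    a leaf of [v] conflicts with that of [v], its only neighbour. *)
Lemma packs_star v (S : {set T}) q :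
  sparse g q -> d.+1 * (3 * d.+1 + 2 * q) <= #|T| ->
  2 * d <= #|leaves_at g v| ->
  {in S &, forall x y, ~~ g x y} -> {in S, forall x, x != v /\ ~~ g v x} ->
  d <= #|S| -> exists p, packs setT p.
Proof.
move=> g_sparse room leL indepS farS dS.
have vS : v \notin S by apply/negP => /farS[]; rewrite eqxx.
have [p0 cover0] := cover_clashes vS dS.
pose P := v |: [set y | h (p0 v) (p0 y)].
have inP z : z \in P -> z = v \/ z \in S.
  by case/setU1P=> [|zh]; [left|right; apply: cover0; rewrite inE in zh].
have packP : packs P p0.
  apply/packsP => x y /inP[->|xS] /inP[->|yS].
  - by rewrite g_irr.
  - by have [_ /negPf->] := farS y yS.
  - by rewrite g_sym; have [_ /negPf->] := farS x xS.
  by rewrite (negPf (indepS x y xS yS)).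
have sizeP : #|P| <= d.+1.
  by rewrite cardsU1 inE h_irr add1n ltnS card_clash.
have PM : P \subset ~: leaves_at g v.
  apply/subsetP => z /inP zP; rewrite !inE negb_and.
  by case: zP => [->|/farS[_ ->]]; rewrite ?g_irr orbT.
have [|p packM pP] := packs_extend g_sparse sizeP (ltnSn d) room PM _ packP.
  by rewrite setCK.
have pv : p v = p0 v by rewrite pP ?setU11.
have good x y : x \in leaves_at g v -> g x y -> ~~ h (p x) (p y).
  move=> x_at gxy; move: (x_at); rewrite inE => /andP[xL gvx].
  rewrite (leaf_nbr_uniq xL gxy (_ : g x v)) 1?g_sym // h_sym pv.
  apply/negP; pose z := (p0^-1)%g (p x).
  have pxz : p x = p0 z by rewrite permKV.
  rewrite pxz => hz.
  have zP : z \in P by apply/setU1P; right; rewrite inE.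
  have xz : x = z by apply: (@perm_inj _ p); rewrite pxz pP.
  by have /(subsetP PM) := zP; rewrite -xz inE x_at.
exists p; apply/packsP => x y _ _ gxy.
case: (boolP (x \in leaves_at g v)) => xL; first exact: good.
case: (boolP (y \in leaves_at g v)) => yL; first by rewrite h_sym good // g_sym.
by have /packsP := packM; apply; rewrite // inE.
Qed.

(** If neither a vertex with [2 * d] leaves nor [4 * d] vertices with leaves
    exist, then the number of leaves is quadratic in [d]; against the cubic
    lower bound on [#|T|] this leaves enough thin vertices. *)
Theorem packing q :
  (forall x y, connect g x y) -> degree_sum g setT <= (#|T| + q).*2 ->
  6 * d.+1 ^ 3 <= #|T| -> q * (24 * d.+1 - 12) <= #|T| ->
  (forall v, exists2 S : {set T}, d <= #|S| &
     {in S &, forall x y, ~~ g x y} /\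
     {in S, forall x, x != v /\ ~~ g v x}) ->
  exists p, packs setT p.
Proof.
move=> g_conn tot leT leq_q far.
have T2 : 2 < #|T|.
  by apply: leq_trans leT; apply: leq_trans (leq_pmulr _ _); rewrite ?expn_gt0.
have g_sparse := sparse_of_connected g_sym g_conn tot.
have room : d.+1 * (3 * d.+1 + 2 * q) <= #|T|.
  have : d.+1 ^ 2 <= d.+1 ^ 3 by apply: leq_pexp2l.
  rewrite -!(cardsT T) in leT leq_q *; nia.
have by_spread I : spread g I -> 4 * d <= #|I| -> exists p, packs setT p.
  move=> spreadI leI.
  have [|||p packI _] := @packs_extend d.+1 q set0 (~: I) 1%g g_sparse
      _ (ltnSn d) room (sub0set _).
  - by rewrite cards0.
  - by rewrite setCK; lia.
  - by apply/packsP => x y; rewrite inE.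
  exact: packs_spread spreadI leI packI.
case: (boolP [exists v, 2 * d <= #|leaves_at g v|]) => [/existsP[v many]|].
  have [S dS [indepS farS]] := far v.
  exact: packs_star g_sparse room many indepS farS dS.
rewrite negb_exists => /forallP few.
have [I spreadI cardI] := spread_leaves g_sym g_conn T2.
have [leI|ltI] := leqP (4 * d) #|I|; first exact: by_spread leI.
have [J spreadJ thinJ] := spread_thin g_sym g_irr.
apply: by_spread spreadJ _.
have deg_pos x : 0 < deg g x by apply: deg_gt0 => //; apply: ltnW.
have leT_thin := card_thin g_sym g_irr deg_pos tot.
have d_gt0 : 0 < d by case: d ltI; rewrite ?muln0.
have few' v : #|leaves_at g v| <= (2 * d).-1.
  by have := few v; rewrite -ltnNge; lia.
apply: few_leaves_bound d_gt0 leT leq_q leT_thin _ thinJ.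
apply: leq_trans (leaves_le g_sym few') _; rewrite -cardI.
by rewrite leq_mul2r; apply/orP; right; lia.
Qed.

End Packing.

(** * Degrees, edges and independence in simple graphs *)

(** An edge comes from at most two ordered pairs of adjacent vertices. *)
Lemma degree_sum_edges (G : sgraph) :
  degree_sum (@adj G) setT <= 2 * #|edges G|.
Proof.
pose pairs := [set p : G * G | adj p.1 p.2].
have -> : degree_sum (@adj G) setT = #|pairs|.
  have pairsE p : (p \in pairs) = xpredT p.1 && adj p.1 p.2 by rewrite inE.
  rewrite -sum1_card (eq_bigl _ _ pairsE).
  rewrite -(pair_big_dep xpredT (fun x y => @adj G x y) (fun _ _ => 1)) /=.
  rewrite /degree_sum; apply: eq_big => x; first by rewrite inE.
  move=> _; rewrite deg_in_setT /deg -sum1_card.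
  by apply: eq_bigl => y; rewrite inE.
have cover : pairs \subset \bigcup_(e in edges G) [set p | [set p.1; p.2] == e].
  apply/subsetP => p; rewrite inE => p_adj; apply/bigcupP.
  by exists [set p.1; p.2]; [apply: imset_f; rewrite inE | rewrite inE].
apply: leq_trans (subset_leq_card cover) _; rewrite mulnC.
apply: card_bigcup_le => _ /imsetP[[x y] _ ->] /=.
apply: (@leq_trans #|[set (x, y); (y, x)]|); last first.
  by rewrite cards2; case: (_ != _).
apply/subset_leq_card/subsetP => -[u v]; rewrite !inE /= => /eqP eq_uv.
have := set21 x y; have := set22 x y; rewrite -eq_uv !inE !xpair_eqE.
have := set21 u v; have := set22 u v; rewrite eq_uv !inE.
by do 4! (case/orP => /eqP ?; subst); rewrite ?eqxx ?orbT //.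
Qed.

Lemma min_degree_le (G : sgraph) (v : G) : min_degree G <= degree v.
Proof.
rewrite /min_degree; have := mem_index_enum v.
elim: (index_enum G) => // w r IHr; rewrite inE big_cons geq_min.
by case/predU1P => [->|/IHr->]; rewrite ?leqnn ?orbT.
Qed.

Lemma alpha'_le (G : sgraph) (v : G) : alpha' G <= alpha (del_closed_nbhd v).
Proof.
rewrite /alpha'; have := mem_index_enum v.
elim: (index_enum G) => // w r IHr; rewrite inE big_cons geq_min.
by case/predU1P => [->|/IHr->]; rewrite ?leqnn ?orbT.
Qed.

Lemma alpha_del_closed_nbhd (G : sgraph) (v : G) :
  exists2 S : {set G}, alpha (del_closed_nbhd v) <= #|S| &
    {in S &, forall x y, ~~ adj x y} /\
    {in S, forall x, x != v /\ ~~ adj v x}.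
Proof.
pose H := del_closed_nbhd v.
have indep0 : independent (set0 : {set H}).
  by apply/forall_inP => x; rewrite inE.
have [|S indepS maxS] :=
  @eq_bigmax_cond _ [pred S : {set H} | independent S] (fun S => #|S|).
  by apply/card_gt0P; exists set0.
exists (val @: S); first by rewrite card_imset ?/alpha ?maxS //; apply: val_inj.
split=> [_ _ /imsetP[x xS ->] /imsetP[y yS ->]|_ /imsetP[x _ ->]].
  by move: indepS => /forall_inP/(_ x xS)/forall_inP/(_ y yS).
by have := valP x; rewrite !inE negb_or => /andP.
Qed.

(** * The embedding *)

Theorem corollary1 (k n : nat) (hk : 1 <= k) (hn : 6 * k ^ 3 <= n)
    (F : sgraph) (hF : #|F| = n) (hdeg : n - k <= min_degree F)
    (G : sgraph) (hG : #|G| = n) (hconn : connected G)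
    (hedges : ((#|edges G|)%:R <= n%:R * (1 + 1 / (24 * k%:R - 12)) :> rat)%R)
    (halpha : k - 1 <= alpha' G) :
  contains F G.
Proof.
case: k hk hn hdeg hedges halpha => // d _ hn hdeg hedges halpha.
have hFG : #|G| = #|F| by rewrite hG hF.
pose f (x : G) : F := enum_val (cast_ord hFG (enum_rank x)).
have f_inj : injective f.
  by move=> x y /enum_val_inj/cast_ord_inj/enum_rank_inj.
(* The complement of [F], transported to the vertices of [G]. *)
pose h x y := (x != y) && ~~ adj (f x) (f y).
have h_deg w : deg h w <= d.
  have leF := leq_trans hdeg (min_degree_le (f w)).
  have : [set f y | y in [set y | h w y]] \subset ~: closed_nbhd (f w).
    apply/subsetP => _ /imsetP[y + ->]; rewrite !inE => /andP[wy Fwy].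
    by rewrite negb_or (inj_eq f_inj) eq_sym wy.
  move/subset_leq_card; rewrite card_imset // => leC.
  apply: leq_trans leC _.
  have := cardsC (closed_nbhd (f w)).
  rewrite [#|closed_nbhd _|]cardsU1 inE adj_irrefl /= hF.
  by move: leF hn; rewrite /degree; lia.
have n_ge6 : 6 <= n by apply: leq_trans hn; rewrite leq_pmulr // expn_gt0.
have edges_le : #|edges G| * (24 * d.+1 - 12) <= n * (24 * d.+1 - 12) + n.
  have c_gt0 : 0 < 24 * d.+1 - 12 by lia.
  have cE : (24 * d.+1%:R - 12 = (24 * d.+1 - 12)%:R :> rat)%R.
    by rewrite GRing.natrB ?GRing.natrM //; lia.
  have c_neq0 : ((24 * d.+1 - 12)%:R != 0 :> rat)%R.
    by rewrite Num.Theory.pnatr_eq0; lia.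
  rewrite -(Num.Theory.ler_nat rat) GRing.natrD !GRing.natrM.
  move: hedges; rewrite cE.
  move=> /(Num.Theory.ler_wpM2r (Num.Theory.ler0n _ (24 * d.+1 - 12))).
  move/Order.POrderTheory.le_trans; apply.
  rewrite -GRing.mulrA GRing.mulrDl GRing.div1r GRing.mul1r.
  by rewrite GRing.mulVf // GRing.mulrDr GRing.mulr1.
have tot : degree_sum (@adj G) setT <= (#|G| + (#|edges G| - n)).*2.
  by apply: leq_trans (degree_sum_edges G) _; rewrite hG; lia.
have [|||||p /packsP packp] :=
  @packing G (@adj G) h d (@adj_sym G) (@adj_irrefl G) _ _ h_deg _ hconn tot.
- by move=> x y; rewrite /h eq_sym adj_sym.
- by move=> x; rewrite /h eqxx.
- by rewrite hG.
- by rewrite hG mulnBl; lia.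
- move=> v; have [S leS HS] := alpha_del_closed_nbhd v; exists S => //.
  by apply: leq_trans leS; apply: leq_trans (alpha'_le v); lia.
exists (fun x => f (p x)); split=> [x y /f_inj/perm_inj //|x y xy].
have := packp x y (in_setT _) (in_setT _) xy.
rewrite /h negb_and negbK.
case/orP => [/eqP/perm_inj xE|]; last by rewrite negbK.
by rewrite xE adj_irrefl in xy.
Qed.
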